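(* Let $(A,B)$ be an ordered pair of non-negative integers. There exist (for some $n\ge 1$) indefinite Hermitian symmetric polynomials $r_1$ and $r_2$ on $\mathbf{C}^n$ such that $\mathbf{s}(r_1 r_2) = (A,B)$ if and only if $(A,B)$ is not one of $(0,0)$, $(1,0)$, $(0,1)$.
   Context: A Hermitian symmetric polynomial on $\mathbf{C}^n$ is a polynomial $p(z,\overline{w}) = \sum_{\alpha,\beta} c_{\alpha\beta} z^\alpha \overline{w}^\beta$ (finite sum over multi-indices, $z,w\in\mathbf{C}^n$) whose coefficient matrix $C=(c_{\alpha\beta})$ is Hermitian; it is identified with the real-valued function $z\mapsto p(z,\overline{z})$. Products are ordinary products of polynomials. The signature pair $\mathbf{s}(p)=(A,B)$ means that $C$ has $A$ positive and $B$ negative eigenvalues (counted with multiplicity). The polynomial $p$ is called indefinite if $\mathbf{s}(p)=(A,B)$ with both $A\neq 0$ and $B\neq 0$. *)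

(* Defs.v *)
From HB Require Import structures.
From mathcomp Require Import all_boot all_order all_algebra.
From mathcomp Require Import reals.
From mathcomp Require Export complex.
From mathcomp.multinomials Require Export mpoly.

Set Implicit Arguments.
Unset Strict Implicit.
Unset Printing Implicit Defensive.

Import Order.TTheory GRing.Theory Num.Theory.
Local Open Scope ring_scope.

(* A polynomial p(z, \bar w) on C^n x C^n is an element of {mpoly C[n + n]}:
   the first n indeterminates stand for the z_i, the last n for the \bar w_i. *)

(* The exponent of z^a \bar w^b. *)
Definition bimnm n (a b : 'X_{1..n}) : 'X_{1..n + n} :=
  [multinom match split i with inl j => a j | inr j => b j end | i < n + n].

Section Signature.
Variables (C : numClosedFieldType) (n : nat).
Implicit Types p : {mpoly C[n + n]}.

(* Rows and columns are indexed by the multi-indices of degree < msize p, where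
   msize p = deg p + 1 (0 if p = 0): all coefficients of p outside this range
   vanish, and so only contribute null eigenvalues. *)
Definition coefmx p : 'M[C]_#|{: 'X_{1..n < msize p}}| :=
  \matrix_(i, j)
    p@_(bimnm (enum_val i : 'X_{1..n < msize p}) (enum_val j : 'X_{1..n < msize p})).

Definition hermitian_symmetric p : bool := coefmx p \is hermsymmx.

(* The roots of the characteristic polynomial, listed with multiplicity. *)
Definition eigenvalues m (M : 'M[C]_m) : seq C :=
  sval (closed_field_poly_normal (char_poly M)).

(* Positivity in a numClosedFieldType entails being real. *)
Definition signature p : nat * nat :=
  (count (fun l => 0 < l) (eigenvalues (coefmx p)),
   count (fun l => l < 0) (eigenvalues (coefmx p))).

Definition indefinite p : bool :=
  ((signature p).1 != 0%N) && ((signature p).2 != 0%N).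

End Signature.

(* Main.v *)
(* For a Hermitian symmetric polynomial, the signature sums to the rank of the
   coefficient matrix.  Suppose that r1 r2 <> 0 has rank one, i.e.
   r1 r2 = f(z) g(\bar w).  A Kronecker substitution z_i := X^(N^i),
   \bar w_i := Y^(N^i) with N large maps distinct monomials of r1 and r2 to
   distinct monomials and so reduces to one variable, where f splits: each X - x
   dividing f divides r1 or r2, and what remains of r1 depends on Y only.  Hence
   r1 has rank one, and cannot be indefinite.

   Conversely, polynomials in x = |z|^2 have a diagonal coefficient matrix, so
   that the signature counts the signs of the coefficients.  Since
   1 + x^9 = (1 - x + x^2) (1 + x - x^3 - x^4 + x^6 + x^7) with both factors
   indefinite, so are the factors 1 - x + x^2 and
   (1 + x - x^3 - x^4 + x^6 + x^7) g(x^9) of h(x^9), where h = (1 + y) g(y) and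
   the coefficients of g are a ones followed by b minus ones.  The
   signature of h is (a, b) if a, b > 0, (a + 1, 0) if b = 0 and (0, b + 1) if
   a = 0. *)

Require Import Defs.
From mathcomp Require Import all_boot all_order all_algebra.
From mathcomp Require Import reals.
From mathcomp Require Import zify ring.

Import Order.TTheory GRing.Theory Num.Theory.
Local Open Scope ring_scope.
Set Implicit Arguments.
Unset Strict Implicit.
Unset Printing Implicit Defensive.

(** * Eigenvalues of Hermitian matrices and rank at most one *)

Lemma char_poly_conj (F : fieldType) n (P A : 'M[F]_n) :
  P \in unitmx -> char_poly (invmx P *m A *m P) = char_poly A.
Proof.
move=> Pu; rewrite /char_poly /char_poly_mx !map_mxM.
have QP : map_mx polyC (invmx P) *m map_mx polyC P = 1%:M.
  by rewrite -map_mxM mulVmx // map_scalar_mx.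
set Q := map_mx polyC P in QP *; set Q' := map_mx polyC (invmx P) in QP *.
have -> : 'X%:M - Q' *m map_mx polyC A *m Q
  = Q' *m ('X%:M - map_mx polyC A) *m Q.
  by rewrite mulmxBr mulmxBl scalar_mxC -(mulmxA 'X%:M) QP mulmx1.
by rewrite !det_mulmx mulrAC -det_mulmx QP det1 mul1r.
Qed.

Section Eigenvalues.
Variable C : numClosedFieldType.

(** Rank at most one; the zero matrix is included. *)
Definition outer n (M : 'M[C]_n) :=
  exists u : 'cV[C]_n, exists v : 'rV[C]_n, M = u *m v.

(** The list [eigenvalues] comes from a choice of roots, so only its content up to permutation is
    determined, which is enough for counting. *)
Lemma perm_eigenvalues n (M : 'M[C]_n) (s : seq C) :
  char_poly M = \prod_(x <- s) ('X - x%:P) -> perm_eq (eigenvalues M) s.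
Proof.
rewrite /eigenvalues; case: closed_field_poly_normal => r /= e1 e2.
apply: prod_XsubC_eq.
by rewrite -e2 e1 (monicP (char_poly_monic M)) scale1r.
Qed.

Lemma perm_eigenvalues_diag n (d : 'rV[C]_n) :
  perm_eq (eigenvalues (diag_mx d)) [seq d 0 i | i <- enum 'I_n].
Proof.
apply: perm_eigenvalues; rewrite char_poly_trig ?diag_mx_is_trig //.
rewrite big_map big_enum; apply: eq_bigr => i _.
by rewrite mxE eqxx.
Qed.

Lemma hermitian_diagonalize n (M : 'M[C]_n) : M \is hermsymmx ->
  exists P : 'M[C]_n, exists d : 'rV[C]_n,
    [/\ P \in unitmx, M = invmx P *m diag_mx d *m P, d \is a mxOver Num.real
      & perm_eq (eigenvalues M) [seq d 0 i | i <- enum 'I_n]].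
Proof.
move=> Mh; exists (spectralmx M), (spectral_diag M).
have Pu := spectral_unit M.
have e : M = invmx (spectralmx M) *m diag_mx (spectral_diag M) *m spectralmx M.
  by have /orthomx_spectralP := hermitian_normalmx Mh.
split=> //; first exact: hermitian_spectral_diag_real.
apply: perm_eigenvalues; rewrite {1}e char_poly_conj // char_poly_trig.
  by rewrite big_map big_enum; apply: eq_bigr => i _; rewrite mxE eqxx.
exact: diag_mx_is_trig.
Qed.

Lemma hermitian_outer n (M : 'M[C]_n) : M \is hermsymmx ->
  (count (fun l => 0 < l)%R (eigenvalues M)
    + count (fun l => l < 0)%R (eigenvalues M) <= 1)%N -> outer M.
Proof.
move=> /hermitian_diagonalize [P] [d] [Pu -> /mxOverP dr /permP e].
rewrite !e -count_predUI => le1.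
have /card_le1_eqP d1 : (#|[pred i | d 0%R i != 0%R]| <= 1)%N.
  apply: leq_trans le1; rewrite cardE size_filter -enumT !count_map.
  apply: leq_trans (leq_addr _ _); apply: eq_leq; apply: eq_count => i /=.
  by rewrite !inE orbC real_neqr_lt // dr.
case: (pickP [pred i | d 0%R i != 0%R]) => [i di | d0]; last first.
  exists 0, 0; rewrite mul0mx; suff -> : diag_mx d = 0 by rewrite mulmx0 mul0mx.
  by apply/matrixP=> k l; rewrite !mxE (eqP (negbFE (d0 k))) mul0rn.
exists (invmx P *m (d 0 i *: delta_mx i 0)), (delta_mx 0 i *m P).
rewrite !mulmxA; congr (_ *m _); rewrite -!mulmxA; congr (_ *m _).
rewrite -scalemxAl mul_delta_mx; apply/matrixP=> k l; rewrite !mxE.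
have [->|ki] := eqVneq k i; first by rewrite eq_sym mulr_natr.
rewrite mulr0; have [->|dk] := eqVneq (d 0 k) 0; first by rewrite mul0rn.
by rewrite (d1 k i) ?inE ?eqxx // in ki.
Qed.

(** If [d_i > 0 > d_j], the diagonalized matrix still has the form [x_k y_l]. Its entry at [(i, j)]
    is 0, so [x_i = 0] or [y_j = 0], which kills [d_i = x_i y_i] or [d_j = x_j y_j]. *)
Lemma outer_eigenvalues n (u : 'cV[C]_n) (v : 'rV[C]_n) :
  u *m v \is hermsymmx ->
  (count (fun l => 0 < l) (eigenvalues (u *m v)) == 0%N)
  || (count (fun l => l < 0) (eigenvalues (u *m v)) == 0%N).
Proof.
move=> /hermitian_diagonalize [P] [d] [Pu duv _ /permP e].
rewrite !e -[_ || _]negbK negb_or -!lt0n -!has_count; apply/negP => /andP[].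
move=> /hasP[_ /mapP[i _ ->] di] /hasP[_ /mapP[j _ ->] dj].
have {}duv : diag_mx d = (P *m u) *m (v *m invmx P).
  rewrite mulmxA -(mulmxA P) duv !mulmxA mulmxK // mulmxV //.
  by rewrite mul1mx.
have dE k l : d 0 k *+ (k == l) = (P *m u) k 0 * (v *m invmx P) 0 l.
  by have /matrixP/(_ k l) := duv; rewrite !mxE big_ord1 => ->; rewrite !mxE.
have ij : i != j.
  by apply/eqP=> eij; have := lt_trans dj di; rewrite eij ltxx.
have := dE i j; rewrite (negPf ij) mulr0n => /esym/eqP; rewrite mulf_eq0.
have ei := dE i i; have ej := dE j j; rewrite !eqxx !mulr1n in ei ej.
by case/orP => /eqP z0; [move: di; rewrite ei | move: dj; rewrite ej];
  rewrite z0 ?mul0r ?mulr0 ltxx.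
Qed.

End Eigenvalues.

(** * Factors of a product of polynomials in separate variables *)

(** Induction on the roots of [f]: each [X - x] divides [P] or [Q] and can be cancelled from both
    sides. *)
Lemma poly2_factorl (F : closedFieldType) (P Q : {poly {poly F}})
    (f g : {poly F}) :
  f^:P * g%:P != 0 -> P * Q = f^:P * g%:P ->
  exists a b : {poly F}, P = a^:P * b%:P.
Proof.
have [s ->] := closed_field_poly_normal f.
(* The leading coefficient of [f] is absorbed into [g], leaving a product of monic linear
   factors. *)
rewrite map_polyZ /= rmorph_prod /= -mul_polyC -mulrA mulrC -mulrA -polyCM.
set h := g * _; rewrite mulf_eq0 negb_or => /andP[_]; rewrite polyC_eq0.
move: h => h h0; elim: s P Q => [|x s IHs] P Q.
  rewrite big_nil mul1r => e; exists 1, P`_0; rewrite rmorph1 mul1r.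
  have PQ0 : P * Q != 0 by rewrite e polyC_eq0.
  have [P0 Q0] : P != 0 /\ Q != 0 by apply/andP; rewrite -negb_or -mulf_eq0.
  (* With no root left, [P * Q] is constant in the outer variable, and by degrees so is [P]. *)
  apply: size1_polyC; have := congr1 (size \o polyseq) e.
  rewrite /= size_polyC h0 size_mul //.
  move: P0 Q0; rewrite -!size_poly_gt0.
  by case: (size P) => [|[|k]] //; case: (size Q) => [|l]; rewrite ?addnS.
rewrite big_cons; set S := \prod_(_ <- _) _ => e.
have : root (P * Q) x%:P.
  by rewrite e !rootM; apply/orP; left; rewrite map_polyXsubC root_XsubC eqxx.
have nz : map_poly polyC ('X - x%:P) != 0.
  by rewrite map_polyXsubC polyXsubC_eq0.
rewrite rootM => /orP[] /factor_theorem [T eT]; rewrite -map_polyXsubC in eT.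
  have [|a [b eab]] := IHs T Q.
    by apply: (mulIf nz); rewrite mulrAC -eT e [RHS]mulrC -mulrA.
  by exists (a * ('X - x%:P)), b; rewrite eT eab rmorphM mulrAC.
apply: (IHs P T).
by apply: (mulIf nz); rewrite -mulrA -eT e [RHS]mulrC -mulrA.
Qed.

(** * Base [N] digits, bidegrees and the Kronecker substitution *)

Lemma digits_inj N n (a b : 'I_n -> nat) :
  (forall i, a i < N)%N -> (forall i, b i < N)%N ->
  (\sum_(i < n) a i * N ^ i = \sum_(i < n) b i * N ^ i)%N -> a =1 b.
Proof.
elim: n a b => [|n IHn] a b aN bN; first by move=> _ [].
rewrite !big_ord_recl /= !expn0 !muln1.
have E (c : 'I_n.+1 -> nat) :
  (\sum_(i < n) c (lift ord0 i) * N ^ (bump 0 i)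
    = (\sum_(i < n) c (lift ord0 i) * N ^ i) * N)%N.
  rewrite big_distrl; apply: eq_bigr => i _.
  by rewrite /bump add1n expnSr mulnA.
rewrite !E => e.
have e0 : a ord0 = b ord0.
  have := congr1 (modn^~ N) e.
  rewrite /= ![(a ord0 + _)%N]addnC ![(b ord0 + _)%N]addnC.
  by rewrite !modnMDl !modn_small.
have N0 : (0 < N)%N by apply: leq_ltn_trans (aN ord0).
move: e; rewrite e0 => /addnI/eqP; rewrite eqn_pmul2r // => /eqP/IHn e i.
case: (unliftP ord0 i) => [j|] -> //; exact: e.
Qed.

Section Bidegree.
Variable n : nat.
Implicit Types (a b : 'X_{1..n}) (m : 'X_{1..n + n}).

Lemma bimnm_lshift a b i : bimnm a b (lshift n i) = a i.
Proof. by rewrite mnmE (unsplitK (inl i)). Qed.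

Lemma bimnm_rshift a b i : bimnm a b (rshift n i) = b i.
Proof. by rewrite mnmE (unsplitK (inr i)). Qed.

Lemma bimnm_inj a b a' b' : bimnm a b = bimnm a' b' -> a = a' /\ b = b'.
Proof.
move=> /mnmP e; split; apply/mnmP=> i.
  by have := e (lshift n i); rewrite !bimnm_lshift.
by have := e (rshift n i); rewrite !bimnm_rshift.
Qed.

Lemma bimnm_surj m : exists a, exists b, m = bimnm a b.
Proof.
exists [multinom m (lshift n i) | i < n], [multinom m (rshift n i) | i < n].
apply/mnmP=> i; case: (split_ordP i) => j ->.
  by rewrite bimnm_lshift mnmE.
by rewrite bimnm_rshift mnmE.
Qed.

Lemma mdeg_bimnm a b : mdeg (bimnm a b) = (mdeg a + mdeg b)%N.
Proof.
rewrite !mdegE big_split_ord; congr (_ + _)%N; apply: eq_bigr => i _.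
  exact: bimnm_lshift.
exact: bimnm_rshift.
Qed.

Lemma mcoeff_bimnm0 (R : nzRingType) k (p : {mpoly R[n + n]}) a b :
  (msize p <= k)%N -> ~~ ((mdeg a < k) && (mdeg b < k))%N ->
  p@_(bimnm a b) = 0.
Proof.
rewrite negb_and -!leqNgt => pk ab; apply: memN_msupp_eq0.
by apply: msize_mdeg_ge; rewrite mdeg_bimnm; lia.
Qed.

(** The bound [k] is left free: it will be [msize] for a product, but a common bound for its two
    factors. *)
Lemma mpoly_bimnmE (R : nzRingType) k (p : {mpoly R[n + n]}) :
  (msize p <= k)%N ->
  p = \sum_(a : 'X_{1..n < k}) \sum_(b : 'X_{1..n < k})
        p@_(bimnm a b) *: 'X_[bimnm a b].
Proof.
move=> pk; apply/mpolyP=> m; have [a [b ->]] := bimnm_surj m.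
have cE (a' b' : 'X_{1..n < k}) :
    (p@_(bimnm a' b') *: 'X_[bimnm a' b'])@_(bimnm a b)
    = p@_(bimnm a b) *+ ((a' == a :> 'X_{1..n}) && (b' == b :> 'X_{1..n})).
  rewrite mcoeffZ mcoeffX; have [/bimnm_inj[-> ->]|ne] := eqVneq.
    by rewrite !eqxx mulr1.
  rewrite mulr0; case: eqP => // ea; case: eqP => // eb.
  by rewrite ea eb eqxx in ne.
rewrite raddf_sum; under eq_bigr => a' _.
  rewrite raddf_sum; under eq_bigr => b' _ do rewrite /= cE.
  over.
have [ab|ab] := boolP ((mdeg a < k) && (mdeg b < k))%N.
  case/andP: ab => ak bk.
  rewrite (bigD1 (BMultinom ak)) //= (bigD1 (BMultinom bk)) //=.
  rewrite !eqxx big1 ?big1 ?addr0 //.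
    move=> a' na; apply: big1 => b' _; rewrite (_ : _ == _ = false) //.
    exact: negbTE.
  move=> b' nb; rewrite (_ : b' == _ :> 'X_{1..n} = false) ?andbF //.
  exact: negbTE.
rewrite big1 => [|a' _]; last first.
  apply: big1 => b' _; case: eqP => // ea; case: eqP => // eb.
  by rewrite -ea -eb !bmdeg in ab.
exact: mcoeff_bimnm0 ab.
Qed.

End Bidegree.

Section Kronecker.
Variables (F : closedFieldType) (n N : nat).
Implicit Types (a b : 'X_{1..n}) (p : {mpoly F[n + n]}).

Definition digit_sum a : nat := \sum_(i < n) a i * N ^ i.

(** The outer variable receives the [z_i] and the inner one the [\bar w_i], as [poly2_factorl]
    requires. *)
Definition kronecker p : {poly {poly F}} :=
  mmap (polyC \o polyC)
    (fun i => match split i with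
              | inl j => 'X^(N ^ j)
              | inr j => ('X^(N ^ j))%:P
              end) p.

Lemma digit_sum_inj a b : (mdeg a < N)%N -> (mdeg b < N)%N ->
  digit_sum a = digit_sum b -> a = b.
Proof.
move=> aN bN e; apply/mnmP; apply: digits_inj e => i.
  by apply: leq_ltn_trans aN; rewrite mdegE (bigD1 i) //= leq_addr.
by apply: leq_ltn_trans bN; rewrite mdegE (bigD1 i) //= leq_addr.
Qed.

(** Nothing relates [k] to [N]: the expansion holds even when distinct monomials collide. *)
Lemma kroneckerE k p : (msize p <= k)%N ->
  kronecker p = \sum_(a : 'X_{1..n < k}) \sum_(b : 'X_{1..n < k})
    (p@_(bimnm a b))%:P%:P * ('X^(digit_sum a) * ('X^(digit_sum b))%:P).
Proof.
move=> pk; rewrite {1}(mpoly_bimnmE pk) /kronecker raddf_sum.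
apply: eq_bigr => a _; rewrite raddf_sum; apply: eq_bigr => b _.
rewrite /= mmapZ mmapX /mmap1 big_split_ord /=; congr (_ * (_ * _)).
  rewrite -prodrXr; apply: eq_bigr => i _.
  by rewrite (unsplitK (inl i)) bimnm_lshift -exprM mulnC.
rewrite -prodrXr rmorph_prod; apply: eq_bigr => i _ /=.
by rewrite (unsplitK (inr i)) bimnm_rshift -rmorphXn -exprM mulnC.
Qed.

Lemma coef_kronecker p a b : (msize p <= N)%N ->
  (mdeg a < N)%N -> (mdeg b < N)%N ->
  (kronecker p)`_(digit_sum a)`_(digit_sum b) = p@_(bimnm a b).
Proof.
move=> pN aN bN; rewrite (kroneckerE pN).
have cE (a' b' : 'X_{1..n < N}) :
  ((p@_(bimnm a' b'))%:P%:P * ('X^(digit_sum a') * ('X^(digit_sum b'))%:P)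
    : {poly {poly F}})`_(digit_sum a)`_(digit_sum b)
  = p@_(bimnm a b) *+ ((a' == a :> 'X_{1..n}) && (b' == b :> 'X_{1..n})).
  rewrite coefCM coefMC coefXn coefCM.
  rewrite (_ : (_ == _) = (a' == a :> 'X_{1..n})); last first.
    apply/eqP/eqP => [/esym/digit_sum_inj -> //|->//]; exact: bmdeg.
  have [->|] := eqVneq; last by rewrite mul0r coef0 mulr0.
  rewrite mul1r coefXn (_ : (_ == _) = (b' == b :> 'X_{1..n})); last first.
    apply/eqP/eqP => [/esym/digit_sum_inj -> //|->//]; exact: bmdeg.
  by have [->|_] := eqVneq; rewrite ?mulr1 ?mulr0.
rewrite !coef_sum; under eq_bigr => a' _.
  rewrite !coef_sum; under eq_bigr => b' _ do rewrite cE.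
  over.
rewrite (bigD1 (BMultinom aN)) //= (bigD1 (BMultinom bN)) //=.
rewrite !eqxx big1 ?big1 ?addr0 //.
  move=> a' na; apply: big1 => b' _; rewrite (_ : _ == _ = false) //.
  exact: negbTE.
move=> b' nb; rewrite (_ : b' == _ :> 'X_{1..n} = false) ?andbF //.
exact: negbTE.
Qed.

Lemma kroneckerM p q : kronecker (p * q) = kronecker p * kronecker q.
Proof. exact: (mmap_is_multiplicative _ _).1. Qed.

Lemma kronecker_eq0 p : (msize p <= N)%N -> (kronecker p == 0) = (p == 0).
Proof.
move=> pN; apply/eqP/eqP => [p0|->]; last exact: raddf0.
apply/mpolyP=> m; have [a [b ->]] := bimnm_surj m; rewrite mcoeff0.
have [/andP[aN bN]|] := boolP ((mdeg a < N) && (mdeg b < N))%N.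
  by rewrite -coef_kronecker // p0 !coef0.
exact: mcoeff_bimnm0.
Qed.

End Kronecker.

(** * Rank one passes from a product to its factors *)

Section Outer.
Variables (C : numClosedFieldType) (n : nat).
Implicit Types p q : {mpoly C[n + n]}.

Lemma outer_coefmx_mull p q :
  p * q != 0 -> outer (coefmx (p * q)) -> outer (coefmx p).
Proof.
move=> pq0 [u [v e]].
have [p0 q0] : p != 0 /\ q != 0 by apply/andP; rewrite -negb_or -mulf_eq0.
(* Injectivity is needed only on the monomials of [p] and [q]; those of [p * q] may collide, since
   only the factored shape of its image is used. *)
pose N := maxn (msize p) (msize q).
have pN : (msize p <= N)%N := leq_maxl _ _.
have qN : (msize q <= N)%N := leq_maxr _ _.
pose k := msize (p * q).
pose f := \sum_(a : 'X_{1..n < k}) u (enum_rank a) 0 *: 'X^(digit_sum N a).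
pose g := \sum_(b : 'X_{1..n < k}) v 0 (enum_rank b) *: 'X^(digit_sum N b).
have fg : kronecker N (p * q) = f^:P * g%:P.
  rewrite (kroneckerE N (leqnn _)) rmorph_sum mulr_suml; apply: eq_bigr => a _.
  rewrite rmorph_sum mulr_sumr; apply: eq_bigr => b _ /=.
  have := congr1 (fun M : 'M_ _ => M (enum_rank a) (enum_rank b)) e.
  rewrite !mxE big_ord1 !enum_rankK => ->.
  rewrite map_polyZ /= map_polyXn -!mul_polyC !polyCM.
  by rewrite mulrACA.
have [||c [d ecd]] := @poly2_factorl _ (kronecker N p) (kronecker N q) f g.
- by rewrite -fg kroneckerM mulf_neq0 ?kronecker_eq0.
- by rewrite -kroneckerM.
exists (\col_i c`_(digit_sum N (enum_val i : 'X_{1..n < msize p}))).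
exists (\row_j d`_(digit_sum N (enum_val j : 'X_{1..n < msize p}))).
apply/matrixP => i j; rewrite !mxE big_ord1 !mxE.
rewrite -(coef_kronecker pN) ?(leq_trans (bmdeg _)) // ecd.
by rewrite coefMC coef_map /= coefCM.
Qed.

End Outer.

(** * Hermitian symmetry and the signature of a product *)

Section Hermitian.
Variables (C : numClosedFieldType) (n : nat).
Implicit Types p q : {mpoly C[n + n]}.

(** This frees the condition from the size of [coefmx], which differs between a product and its
    factors. *)
Lemma hermitian_symmetricP p :
  reflect (forall a b, p@_(bimnm a b) = (p@_(bimnm b a))^*)
          (hermitian_symmetric p).
Proof.
apply: (iffP (is_hermitianmxP _ _ _)); rewrite expr0 scale1r => h.
  move=> a b; have [/andP[ap bp]|ab] :=
    boolP ((mdeg a < msize p) && (mdeg b < msize p))%N; last first.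
    by rewrite !(mcoeff_bimnm0 (leqnn _)) ?rmorph0 // andbC.
  have /matrixP/(_ (enum_rank (BMultinom ap)) (enum_rank (BMultinom bp))) := h.
  by rewrite !mxE !enum_rankK.
by apply/matrixP => i j; rewrite !mxE h.
Qed.

Definition half_swap (i : 'I_(n + n)) : 'I_(n + n) :=
  match split i with inl j => rshift n j | inr j => lshift n j end.

Lemma half_swapK : involutive half_swap.
Proof.
move=> i; rewrite /half_swap; case: (split_ordP i) => j ->.
  by rewrite (unsplitK (inr j)).
by rewrite (unsplitK (inl j)).
Qed.

(** On coefficients this is the conjugate transpose. Being multiplicative, it makes Hermitian
    symmetry, as a fixed-point condition, stable under products. *)
Definition bar p : {mpoly C[n + n]} :=
  msym (perm.perm (inv_inj half_swapK)) (map_mpoly Num.Def.conjC p).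

Lemma mcoeff_bar p a b : (bar p)@_(bimnm a b) = (p@_(bimnm b a))^*.
Proof.
rewrite mcoeff_sym mcoeff_map_mpoly /=; congr (Num.conj (mcoeff _ p)).
apply/mnmP => i; rewrite mnmE perm.permE /half_swap.
case: (split_ordP i) => j ->.
  by rewrite bimnm_lshift bimnm_rshift.
by rewrite bimnm_lshift bimnm_rshift.
Qed.

Lemma hermitian_symmetric_bar p : hermitian_symmetric p = (bar p == p).
Proof.
apply/hermitian_symmetricP/eqP => [h | e a b].
  by apply/mpolyP=> m; have [a [b ->]] := bimnm_surj m; rewrite mcoeff_bar -h.
by rewrite -mcoeff_bar e.
Qed.

Lemma hermitian_symmetricM p q : hermitian_symmetric p ->
  hermitian_symmetric q -> hermitian_symmetric (p * q).
Proof.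
rewrite !hermitian_symmetric_bar /bar rmorphM msymM => /eqP e1 /eqP e2.
by rewrite e1 e2.
Qed.

Lemma outer_not_indefinite p :
  hermitian_symmetric p -> outer (coefmx p) -> ~~ indefinite p.
Proof.
rewrite /hermitian_symmetric /indefinite /= => + [u [v e]].
rewrite e negb_and !negbK; exact: outer_eigenvalues.
Qed.

Lemma signature_mul p q : hermitian_symmetric p -> hermitian_symmetric q ->
  indefinite p -> indefinite q ->
  (1 < (signature (p * q)).1 + (signature (p * q)).2)%N.
Proof.
move=> hp hq ip iq; rewrite ltnNge; apply/negP => /hermitian_outer.
move/(_ (hermitian_symmetricM hp hq)) => opq.
(* [outer] allows the zero matrix, so the product must be shown nonzero before its factors are
   examined. *)
have nz (r : {mpoly C[n + n]}) :
    hermitian_symmetric r -> indefinite r -> r != 0.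
  move=> hr; apply: contraTneq => r0; apply: outer_not_indefinite => //.
  exists 0, 0; rewrite mul0mx r0; apply/matrixP=> i j.
  by rewrite !mxE mcoeff0.
suff /(outer_not_indefinite hp) : outer (coefmx p) by rewrite ip.
by apply: outer_coefmx_mull opq; rewrite mulf_neq0 ?nz.
Qed.

End Hermitian.

(** * Coefficient lists in one variable *)

Lemma Poly_cat (R : nzRingType) (s t : seq R) :
  Poly (s ++ t) = Poly s + Poly t * 'X^(size s).
Proof.
elim: s => [|c s IHs] /=; first by rewrite add0r mulr1.
by rewrite IHs !cons_poly_def mulrDl exprSr mulrA addrAC.
Qed.

(** [Poly] only drops trailing zeros, which [P] does not count. *)
Lemma count_Poly (R : nzRingType) (P : pred R) (s : seq R) :
  ~~ P 0 -> count P (Poly s) = count P s.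
Proof.
move=> P0; elim: s => [|c s IHs] /=; first by rewrite polyseq0.
rewrite polyseq_cons; case: nilP => [e|_]; last by rewrite /= IHs.
rewrite -IHs e polyseqC addn0; case: eqVneq => [->|_] /=; last by rewrite addn0.
by rewrite (negbTE P0).
Qed.

(** The shifted copies of [w] do not overlap, so they are concatenated; zeros at the end of [w]
    serve as padding. *)
Lemma Poly_flatten (R : comNzRingType) (w s : seq R) :
  Poly w * (Poly s \Po 'X^(size w))
    = Poly (flatten [seq [seq c * x | x <- w] | c <- s]).
Proof.
have PZ c : Poly [seq c * x | x <- w] = c *: Poly w.
  elim: w => [|x w IHw] /=; first by rewrite scaler0.
  by rewrite IHw !cons_poly_def scalerDr scalerAl -!mul_polyC polyCM.
elim: s => [|c s IHs] /=; first by rewrite comp_poly0 mulr0.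
rewrite Poly_cat -IHs size_map PZ cons_poly_def comp_polyD comp_polyM.
by rewrite comp_polyX comp_polyC mulrDr mulrA addrC [X in X + _]mulrC mul_polyC.
Qed.

(** Multiplying by [1 + X] adds neighbouring coefficients. The entry [x] preceding [s] is general
    for the induction, and the final 0 closes the last sum. *)
Lemma Poly_pairmap (R : comNzRingType) (x : R) (s : seq R) :
  (1 + 'X) * Poly s + x%:P = Poly (pairmap +%R x (rcons s 0)).
Proof.
elim: s x => [|y s IHs] x /=.
  by rewrite mulr0 add0r addr0 cons_poly_def mul0r add0r.
by rewrite -IHs !cons_poly_def polyCD; ring.
Qed.

(** * Polynomials in [|z|^2] *)

Section Diagonal.
Variable C : numClosedFieldType.
Implicit Types p q : {poly int}.

Definition diag_mpoly p : {mpoly C[1 + 1]} :=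
  (map_poly intr p).['X_(lshift 1 ord0) * 'X_(rshift 1 ord0)].

Lemma diag_mpolyM p q : diag_mpoly (p * q) = diag_mpoly p * diag_mpoly q.
Proof. by rewrite /diag_mpoly rmorphM hornerM. Qed.

Lemma mcoeff_diag_mpoly p (a b : 'X_{1..1}) :
  (diag_mpoly p)@_(bimnm a b) = (p`_(a ord0))%:~R *+ (a == b).
Proof.
pose e k : 'X_{1..1} := [multinom k | i < 1].
have eE (c : 'X_{1..1}) k : (e k == c) = (k == c ord0).
  apply/eqP/eqP => [<-|->]; first by rewrite mnmE.
  by apply/mnmP => i; rewrite mnmE (ord1 i).
have XE k : ('X_(lshift 1 ord0) * 'X_(rshift 1 ord0)) ^+ k
  = 'X_[bimnm (e k) (e k)] :> {mpoly C[1 + 1]}.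
  rewrite -mpolyXD mpolyXn; congr ('X_[_]); apply/mnmP=> i.
  rewrite mulmnE mnmDE !mnm1E; case: (split_ordP i) => j ->.
    by rewrite (ord1 j) bimnm_lshift mnmE eqxx eq_rlshift addn0 mul1n.
  by rewrite (ord1 j) bimnm_rshift mnmE eqxx eq_lrshift mul1n.
rewrite /diag_mpoly /map_poly horner_poly raddf_sum /=.
transitivity (\sum_(i < size p)
  ((p`_i)%:~R *+ ((i == a ord0 :> nat) && (a == b)) : C)).
  apply: eq_bigr => i _; rewrite XE.
  rewrite mulrzl raddfMz /= mcoeffX -mulrzl mulr_natr.
  congr (_ *+ nat_of_bool _).
  have [/bimnm_inj[<- <-]|ne] := eqVneq; first by rewrite eqxx mnmE eqxx.
  case: eqP => //= ia; case: eqP => //= eab; move: ne.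
  by rewrite -eab (_ : a = e i) ?eqxx //; apply/esym/eqP; rewrite eE ia.
case: (altP (a =P b)) => _ /=; last by apply: big1 => i _; rewrite andbF mulr0n.
have [lt|ge] := ltnP (a ord0) (size p).
  rewrite (bigD1 (Ordinal lt)) //= eqxx mulr1n big1 ?addr0 // => i ne.
  by rewrite (_ : _ == _ = false) ?mulr0n //; apply: negbTE.
rewrite nth_default // big1 // => i _.
by rewrite (_ : _ == _ = false) ?mulr0n // ltn_eqF // (leq_trans _ ge).
Qed.

Lemma hermitian_diag_mpoly p : hermitian_symmetric (diag_mpoly p).
Proof.
apply/hermitian_symmetricP => a b; rewrite !mcoeff_diag_mpoly eq_sym.
by case: eqP => [->|]; rewrite ?mulr1n ?mulr0n ?rmorph_int ?rmorph0.
Qed.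

Lemma signature_diag_mpoly p : signature (diag_mpoly p)
  = (count (fun c => 0 < c)%R (p : seq int),
     count (fun c => c < 0)%R (p : seq int)).
Proof.
set m := msize (diag_mpoly p).
(* The index range of [coefmx] reaches every coefficient of [p]: otherwise the leading one would sit
   at a degree where [diag_mpoly p] vanishes. *)
have pm : (size p <= m)%N.
  rewrite leqNgt; apply/negP => mp.
  pose e : 'X_{1..1} := [multinom (size p).-1 | i < 1].
  have : (diag_mpoly p)@_(bimnm e e) = 0.
    apply: memN_msupp_eq0; apply: msize_mdeg_ge; rewrite mdeg_bimnm mdegE.
    by rewrite big_ord1 mnmE -/m; lia.
  rewrite mcoeff_diag_mpoly eqxx mnmE mulr1n => /eqP; rewrite intr_eq0.
  by rewrite -/(lead_coef p) lead_coef_eq0 => /eqP p0;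
    rewrite p0 size_poly0 in mp.
pose d : 'rV[C]_#|{: 'X_{1..1 < m}}| :=
  \row_i (p`_((enum_val i : 'X_{1..1 < m}) ord0))%:~R.
have cE : coefmx (diag_mpoly p) = diag_mx d.
  apply/matrixP=> i j; rewrite !mxE mcoeff_diag_mpoly.
  congr (_ *+ nat_of_bool _).
  by rewrite (inj_eq val_inj) (inj_eq enum_val_inj).
have count_key (P : pred int) (Q : pred C) :
    ~~ P 0 -> (forall c, Q c%:~R = P c) ->
    count Q (eigenvalues (coefmx (diag_mpoly p))) = count P (p : seq int).
  move=> P0 QP; rewrite cE.
  have /permP -> := perm_eigenvalues_diag d.
  pose key (i : 'I_#|{: 'X_{1..1 < m}}|) := (enum_val i : 'X_{1..1 < m}) ord0.
  have -> : [seq d 0%R i | i <- enum 'I_#|{: 'X_{1..1 < m}}|]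
      = [seq c%:~R | c <- [seq p`_k | k <- [seq key i | i <- enum 'I__]]].
    by rewrite -!map_comp; apply: eq_map => i; rewrite /d /= mxE.
  (* With one variable, the multi-indices of degree below [m] are the exponents [0, ..., m - 1],
     each met once. *)
  have /permP -> : perm_eq
      [seq (c%:~R : C) | c <- [seq p`_k | k <- [seq key i | i <- enum 'I__]]]
      [seq c%:~R | c <- [seq p`_k | k <- iota 0 m]].
    do 2!apply: perm_map; apply: uniq_perm; rewrite ?iota_uniq //.
      rewrite map_inj_uniq ?enum_uniq // => i j e.
      by apply/enum_val_inj/val_inj/mnmP => l; rewrite (ord1 l).
    move=> k; rewrite mem_iota /= add0n; apply/mapP/idP => [[i _ ->]|km].
      by have := bmdeg (enum_val i : 'X_{1..1 < m}); rewrite mdegE big_ord1.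
    have ek : (mdeg [multinom k | i < 1] < m)%N by rewrite mdegE big_ord1 mnmE.
    exists (enum_rank (BMultinom ek)); first by rewrite mem_enum.
    by rewrite /key enum_rankK mnmE.
  rewrite count_map (eq_count QP) -(subnKC pm) iotaD map_cat count_cat.
  rewrite map_nth_iota0 // take_size -[RHS]addn0; congr (_ + _)%N.
  apply/eqP; rewrite eqn0Ngt -has_count; apply/hasPn => _ /mapP[k + ->].
  by rewrite mem_iota => /andP[ge _]; rewrite nth_default.
rewrite /signature; congr (_, _); apply: count_key => //= c.
  exact: ltr0z.
exact: ltrz0.
Qed.

End Diagonal.

(** * Sign patterns realizing a given pair *)

Lemma pairmap_nseq (c : int) k :
  pairmap +%R c (nseq k c) = nseq k (c + c).
Proof. by elim: k => //= k ->. Qed.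

Lemma last_nseq (T : Type) (x c : T) k :
  last x (nseq k c) = if k is 0 then x else c.
Proof. by elim: k x => //= k IHk x; rewrite IHk; case: k {IHk}. Qed.

(* By Poly_pairmap, the pairmap lists the coefficients of (1 + X) Poly s. *)
Lemma sign_block_counts A B : (A, B) \notin [:: (0, 0); (1, 0); (0, 1)]%N ->
  exists s : seq int, [/\ s != [::], all (fun c => c \in [:: 1; -1]) s,
    count (fun c => 0 < c)%R (pairmap +%R 0 (rcons s 0)) = A
    & count (fun c => c < 0)%R (pairmap +%R 0 (rcons s 0)) = B].
Proof.
have pN k : pairmap +%R 1 (nseq k 1) = nseq k 2 :> seq int.
  exact: pairmap_nseq.
have nN k : pairmap +%R (-1) (nseq k (-1)) = nseq k (-2) :> seq int.
  exact: pairmap_nseq.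
case: A B => [|A] [|B] //=.
(* The sums are -1, then -2 repeated [B] times, then -1: [B + 2] negative entries. *)
- case: B => [|B] // _; exists (nseq B.+1 (-1)); split => //.
  + by rewrite all_nseq.
  + rewrite -cats1 pairmap_cat /= nN count_cat count_nseq last_nseq /=.
    by case: B.
  + rewrite -cats1 pairmap_cat /= nN count_cat count_nseq last_nseq /=.
    by case: B => //= B; lia.
- case: A => [|A] // _; exists (nseq A.+1 1); split => //.
  + by rewrite all_nseq.
  + rewrite -cats1 pairmap_cat /= pN count_cat count_nseq last_nseq /=.
    by case: A => //= A; lia.
  + rewrite -cats1 pairmap_cat /= pN count_cat count_nseq last_nseq /=.
    by case: A.
(* The sums are 1, 2 repeated [A] times, 0 at the sign change, -2 repeated [B] times, and -1. *)
move=> _; exists (nseq A.+1 1 ++ nseq B.+1 (-1)); split=> //.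
- rewrite all_cat; apply/andP; split; apply/allP => c /nseqP[-> _] //.
- rewrite -cats1 !pairmap_cat /= pN nN !count_cat last_cat /=
    !count_nseq !last_nseq.
  by case: A; case: B => //=; lia.
- rewrite -cats1 !pairmap_cat /= pN nN !count_cat last_cat /=
    !count_nseq !last_nseq.
  by case: A; case: B => //=; lia.
Qed.

Lemma product_counts A B : (A, B) \notin [:: (0, 0); (1, 0); (0, 1)]%N ->
  exists p q : {poly int},
    [/\ has (fun c => 0 < c)%R p && has (fun c => c < 0)%R p,
        has (fun c => 0 < c)%R q && has (fun c => c < 0)%R q,
        count (fun c => 0 < c)%R (p * q : {poly int}) = A
      & count (fun c => c < 0)%R (p * q : {poly int}) = B].
Proof.
move=> /sign_block_counts[s [s0 /allP s1 cA cB]].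
(* Coefficients of [1 + x - x^3 - x^4 + x^6 + x^7], padded by a zero to length 9 to match ['X^9]. *)
pose w : seq int := [:: 1; 1; 0; -1; -1; 0; 1; 1; 0].
exists (Poly [:: 1; -1; 1]), (Poly w * (Poly s \Po 'X^9)).
(* As [(1 - x + x^2) w(x) = 1 + x^9], the product is [(1 + y) s(y)] at [y = x^9]: its coefficients
   are spread out by eight zeros each. *)
have -> : Poly [:: 1; -1; 1] * (Poly w * (Poly s \Po 'X^9))
  = Poly (flatten [seq [seq c * x | x <- [:: 1; 0; 0; 0; 0; 0; 0; 0; 0]]
      | c <- pairmap +%R 0 (rcons s 0)]).
  rewrite -Poly_flatten -Poly_pairmap addr0 comp_polyM comp_polyD comp_polyX.
  rewrite rmorph1 /= !cons_poly_def /=.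
  by rewrite !polyCN; ring.
have count_spread (P : pred int) (t : seq int) : ~~ P 0 ->
  count P (flatten [seq [seq c * x | x <- [:: 1; 0; 0; 0; 0; 0; 0; 0; 0]]
    | c <- t]) = count P t.
  move=> P0; elim: t => //= c t <-.
  by rewrite mulr1 mulr0 (negbTE P0).
rewrite (Poly_flatten w) !count_Poly // !count_spread //; split=> //.
  by rewrite !has_count !count_Poly.
rewrite !has_count !count_Poly // -!has_count.
(* The first block of the second factor is [w] or [-w], which already has both signs. *)
case: s s0 s1 {cA cB} => // c s _ /(_ c (mem_head _ _)).
by rewrite !inE => /orP[] /eqP->.
Qed.

Theorem theorem4p1 (R : realType) (A B : nat) :
  (exists n : nat, (1 <= n)%N /\
     exists r1 r2 : {mpoly R[i][n + n]},
       [/\ hermitian_symmetric r1, hermitian_symmetric r2,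
           indefinite r1, indefinite r2
         & signature (r1 * r2) = (A, B)])
  <-> (A, B) \notin [:: (0, 0); (1, 0); (0, 1)]%N.
Proof.
split=> [[n [_ [r1 [r2 [h1 h2 i1 i2 e]]]]] | AB].
  (* The excluded pairs are exactly those with [A + B <= 1]. *)
  have := signature_mul h1 h2 i1 i2; rewrite e /=.
  by case: A {e} => [|[|A]]; case: B => [|[|B]].
have [p [q [ip iq eA eB]]] := product_counts AB.
exists 1%N; split=> //; exists (diag_mpoly _ p), (diag_mpoly _ q).
rewrite -diag_mpolyM /indefinite !signature_diag_mpoly eA eB /=.
by split; rewrite ?hermitian_diag_mpoly // -!lt0n -!has_count.
Qed.
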